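(* Let $R>0$ and let $z_1,\dots,z_m$ be pairwise distinct real numbers with $|z_k|<R$ for every $k$; put $r_k=z_k/R$, $\bm\nu_\ell=(r_1^{\ell-1},\dots,r_m^{\ell-1})^\top$ (with $0^0=1$), and $$\bm A_L(z)=\frac{1}{4R^2}\sum_{\ell=1}^L\ell^2\,\bm\nu_\ell\bm\nu_\ell^\top,\qquad \bm I_C^{\mathrm{poly}}(L)=\kappa_L^{-1}\bm A_L(z),$$ where $\kappa_L>0$. Then the matrix sequence $\bm A_L(z)$ increases monotonically (in the Loewner order) to a finite positive-definite limit $$\bm A_\infty(z)=\frac{1}{4R^2}\sum_{\ell=1}^\infty\ell^2\,\bm\nu_\ell\bm\nu_\ell^\top\succ\bm 0.$$ Consequently, there exist constants $0<c_-\le c_+<\infty$, depending on $z$ and $R$ but not on $L$, such that for all $L\ge m$ $$c_-\,\kappa_L^{-1}\bm I_m\preceq\bm I_C^{\mathrm{poly}}(L)\preceq c_+\,\kappa_L^{-1}\bm I_m,$$ where $\bm I_m$ is the $m\times m$ identity matrix. Consequently $\mathrm{CRB}_{\mathrm{unlab}}^{\mathrm{poly}}(L)=\Theta(\kappa_L)$ (for $L\ge m$).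
   Context: Here $\bm I_C^{\mathrm{poly}}(L)$ is the Fisher information matrix for the sorted vector $z=(z_1<\cdots<z_m)$ from noisy releases of the first $L$ moments $q_\ell(z)=\frac1m\sum_{k=1}^m z_k^\ell$, $\ell=1,\dots,L$, with independent Gaussian noises of variance $\sigma_\ell^2=\kappa_L\Delta_{2,\ell}^2$, where the sensitivity is calibrated as $\Delta_{2,\ell}=2R^\ell/m$ (fixed-cardinality swap adjacency on $[-R,R]$) and $\kappa_L>0$ is the privacy-accountant noise penalty for $L$ releases (under uniform Basic Composition with total budget $(\varepsilon_{\mathrm{tot}},\delta_{\mathrm{tot}})$, $\kappa_L=2L^2\ln(1.25L/\delta_{\mathrm{tot}})/\varepsilon_{\mathrm{tot}}^2$). The benchmark is $\mathrm{CRB}_{\mathrm{unlab}}^{\mathrm{poly}}(L):=\operatorname{tr}\bigl(\bm I_C^{\mathrm{poly}}(L)^{-1}\bigr)$. *)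

(* Defs.v *)
From HB Require Import structures.
From mathcomp Require Import all_boot all_order all_algebra.
From mathcomp Require Import all_classical all_reals all_analysis.

Set Implicit Arguments.
Unset Strict Implicit.
Unset Printing Implicit Defensive.

Import Order.TTheory GRing.Theory Num.Theory.
Import numFieldNormedType.Exports.

Local Open Scope classical_set_scope.
Local Open Scope ring_scope.

Definition psdmx (K : realType) (m : nat) (A : 'M[K]_m) : Prop :=
  A^T = A /\ forall x : 'cV[K]_m, 0 <= (x^T *m A *m x) 0 0.

Definition pdmx (K : realType) (m : nat) (A : 'M[K]_m) : Prop :=
  A^T = A /\ forall x : 'cV[K]_m, x != 0 -> 0 < (x^T *m A *m x) 0 0.

Definition loewner_le (K : realType) (m : nat) (A B : 'M[K]_m) : Prop :=
  psdmx (B - A).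

(* The exponent is natural, so 0 ^+ 0 = 1; only l >= 1 is ever used, where
   l.-1 is the true predecessor. *)
Definition moment_vec (K : realType) (m : nat) (R : K) (z : 'I_m -> K)
    (l : nat) : 'cV[K]_m :=
  \col_k (z k / R) ^+ l.-1.

Definition moment_term (K : realType) (m : nat) (R : K) (z : 'I_m -> K)
    (l : nat) : 'M[K]_m :=
  l%:R ^+ 2 *: (moment_vec R z l *m (moment_vec R z l)^T).

Definition A_poly (K : realType) (m : nat) (R : K) (z : 'I_m -> K)
    (L : nat) : 'M[K]_m :=
  (4 * R ^+ 2)^-1 *: \sum_(1 <= l < L.+1) moment_term R z l.

(* The infinite sum is the limit, in the matrix space, of the partial sums;
   [lim] is total, so convergence has to be asserted separately. *)
Definition A_poly_infty (K : realType) (m : nat) (R : K) (z : 'I_m -> K) :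
    'M[K]_m :=
  (4 * R ^+ 2)^-1 *: \big[+%R/0]_(1 <= l <oo) moment_term R z l.

(* Fisher information of z from the noisy moments
   m^-1 * \sum_k z_k ^+ l + N(0, s_l ^+ 2), 1 <= l <= L, with
   s_l ^+ 2 = kappa * (2 * R ^+ l / m) ^+ 2: the gradient of the l-th moment is
   (l / m) * R ^+ l.-1 times [moment_vec R z l], so its squared ratio to s_l
   gives the weight l ^+ 2 / (4 * R ^+ 2 * kappa). *)
Definition fisher_poly (K : realType) (m : nat) (R : K) (z : 'I_m -> K)
    (kappa : nat -> K) (L : nat) : 'M[K]_m :=
  (kappa L)^-1 *: A_poly R z L.

Definition CRB_poly (K : realType) (m : nat) (R : K) (z : 'I_m -> K)
    (kappa : nat -> K) (L : nat) : K :=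
  \tr (invmx (fisher_poly R z kappa L)).

(* Main.v *)
(* For [|z k| < R] the entries of the partial sums are the convergent series
   [\sum_l l^2 (r_i r_j)^(l-1)], and the increments are positive semidefinite, so
   every partial sum lies below the limit. The m-th partial sum is the Gram
   matrix [B^T B] of a row-scaled Vandermonde matrix, invertible because the
   nodes are distinct; hence [c I <= A_m <= A_L <= A_infty <= C I] for all
   [L >= m]. The diagonal of the inverse of a matrix between [a I] and [b I]
   lies between [1/b] and [1/a], which bounds its trace. *)
Require Import Defs.
From HB Require Import structures.
From mathcomp Require Import all_boot all_order all_algebra.
From mathcomp Require Import all_classical all_reals all_analysis.
From mathcomp Require Import ring lra.
Import Order.TTheory GRing.Theory Num.Theory.
Import numFieldNormedType.Exports.
Local Open Scope classical_set_scope.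
Local Open Scope ring_scope.

(** * Quadratic forms, the Loewner order and bounds on inverses *)

Section QuadraticForms.
Context {K : realType} {m : nat}.
Implicit Types (A B C : 'M[K]_m) (x y : 'cV[K]_m).

Definition qform A x : K := (x^T *m A *m x) 0 0.

Lemma qformE A x : qform A x = \sum_i \sum_j A i j * (x i 0 * x j 0).
Proof.
rewrite /qform -mulmxA mxE; apply: eq_bigr => i _.
by rewrite !mxE mulr_sumr; apply: eq_bigr => j _; ring.
Qed.

Lemma qformB A B x : qform (A - B) x = qform A x - qform B x.
Proof. by rewrite /qform mulmxBr mulmxBl !mxE. Qed.

Lemma qformZ k A x : qform (k *: A) x = k * qform A x.
Proof. by rewrite /qform -scalemxAr -scalemxAl mxE. Qed.

Lemma qform_scalar k x : qform k%:M x = k * \sum_i x i 0 ^+ 2.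
Proof.
rewrite /qform mul_mx_scalar -scalemxAl mxE; congr (_ * _).
by rewrite mxE; apply: eq_bigr => i _; rewrite mxE expr2.
Qed.

Lemma qform_gram {n} (B : 'M[K]_(n, m)) x :
  qform (B^T *m B) x = \sum_i (B *m x) i 0 ^+ 2.
Proof.
rewrite /qform mulmxA -trmx_mul -mulmxA mxE.
by apply: eq_bigr => i _; rewrite mxE expr2.
Qed.

Lemma loewner_leP {A B} : A^T = A -> B^T = B ->
  loewner_le A B <-> forall x, qform A x <= qform B x.
Proof.
move=> sA sB; split=> [[_ le] x | le].
  by rewrite -subr_ge0 -qformB; apply: le.
split=> [|x]; first by rewrite linearB /= sA sB.
by rewrite -/(qform _ x) qformB subr_ge0.
Qed.

Lemma loewner_le_trans {A B C} :
  loewner_le A B -> loewner_le B C -> loewner_le A C.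
Proof.
rewrite /loewner_le => -[sAB leAB] [sBC leBC].
have -> : C - A = (C - B) + (B - A) by rewrite addrA subrK.
split=> [|x]; first by rewrite linearD /= sAB sBC.
by rewrite mulmxDr mulmxDl mxE addr_ge0.
Qed.

Lemma loewner_leZ {k A B} : 0 <= k ->
  loewner_le A B -> loewner_le (k *: A) (k *: B).
Proof.
move=> k0 [s le]; rewrite /loewner_le -scalerBr; split=> [|x].
  by rewrite linearZ /= s.
by rewrite -/(qform _ x) qformZ mulr_ge0 //; apply: le.
Qed.

(** Each product of two coordinates of [x] is at most the squared norm of [x] in absolute value, so
    the sum of the absolute entries of [A] works. *)
Lemma sym_loewner_le_scalar {A} : A^T = A ->
  exists2 c, 0 < c & loewner_le A c%:M.
Proof.
(* The summand 1 keeps the constant positive even when [A] is zero. *)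
move=> sA; exists (1 + \sum_i \sum_j `|A i j|).
  by rewrite ltr_wpDr ?ltr01 // sumr_ge0 // => i _; rewrite sumr_ge0.
apply/loewner_leP; rewrite ?tr_scalar_mx // => x.
set N := \sum_i x i 0 ^+ 2.
have N0 : 0 <= N by rewrite sumr_ge0 // => i _; rewrite sqr_ge0.
have leN i : x i 0 ^+ 2 <= N.
  by rewrite /N (bigD1 i) //= lerDl sumr_ge0 // => j _; rewrite sqr_ge0.
rewrite qform_scalar -/N mulrDl mul1r qformE.
rewrite (le_trans _ (_ : (\sum_i \sum_j `|A i j|) * N <= _)) ?lerDr //.
rewrite mulr_suml ler_sum // => i _; rewrite mulr_suml ler_sum // => j _.
apply: le_trans (ler_norm _) _; rewrite normrM ler_wpM2l //.
(* The squares of [a + b] and [a - b] bound [a * b] in absolute value by the mean of [a ^+ 2] and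
   [b ^+ 2], hence by [N]. *)
have := leN i; have := leN j; rewrite ler_norml; move: (x i 0) (x j 0) => a b.
by move=> hb ha; have := sqr_ge0 (a + b); have := sqr_ge0 (a - b);
  rewrite sqrrB sqrrD => h1 h2; apply/andP; split; lra.
Qed.

(* With y = Bx, the bound |x|^2 <= c |y|^2 is an upper bound on the Gram matrix
   of B^-1. *)
Lemma scalar_loewner_le_gram {B} : B \in unitmx ->
  exists2 c, 0 < c & loewner_le c%:M (B^T *m B).
Proof.
move=> uB; have [|c c0] := @sym_loewner_le_scalar ((invmx B)^T *m invmx B).
  by rewrite trmx_mul trmxK.
move=> /loewner_leP; rewrite trmx_mul trmxK tr_scalar_mx => /(_ erefl erefl) le.
exists c^-1; first by rewrite invr_gt0.
apply/loewner_leP; rewrite ?tr_scalar_mx ?trmx_mul ?trmxK // => x.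
have := le (B *m x); rewrite (qform_gram (invmx B)) mulmxA mulVmx // mul1mx.
by rewrite (qform_gram B) !qform_scalar => h; rewrite mulrC ler_pdivrMr // mulrC.
Qed.

Lemma scalar_loewner_le_pd {c A} : 0 < c -> A^T = A ->
  loewner_le c%:M A -> pdmx A.
Proof.
move=> c0 sA /loewner_leP; rewrite tr_scalar_mx => /(_ erefl sA) le.
split=> // x x0; apply: lt_le_trans (le x); rewrite qform_scalar mulr_gt0 //.
have sq_ge0 (i : 'I_m) : true -> 0 <= x i 0 ^+ 2 by rewrite sqr_ge0.
rewrite lt_neqAle sumr_ge0 // andbT eq_sym psumr_eq0 //.
apply: contra x0 => /allP h; apply/eqP/matrixP => i j.
by apply/eqP; rewrite ord1 mxE -sqrf_eq0; apply: (h i); rewrite mem_index_enum.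
Qed.

(** A row [v] with [v *m A = 0] makes the form vanish at [v^T], so it is zero. *)
Lemma pdmx_unit {A} : pdmx A -> A \in unitmx.
Proof.
move=> [_ pA]; rewrite -row_free_unit; apply: inj_row_free => v vA.
apply/eqP; apply: contraT => v0; have := pA v^T.
by rewrite trmxK vA mul0mx mxE ltxx -trmx_eq0 trmxK; apply.
Qed.

(* With y the i-th column of the inverse, [qform A y] is the diagonal entry
   [y i 0]; evaluating A at y bounds it above, and evaluating A at y - e_i/b
   bounds it below. *)
Lemma invmx_diag_bounds {a b A} (i : 'I_m) : 0 < a -> 0 < b -> A^T = A ->
  loewner_le a%:M A -> loewner_le A b%:M -> b^-1 <= invmx A i i <= a^-1.
Proof.
move=> a0 b0 sA leaA leAb.
have uA := pdmx_unit (scalar_loewner_le_pd a0 sA leaA).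
move: leaA leAb => /loewner_leP; rewrite tr_scalar_mx => /(_ erefl sA) leaA.
move=> /loewner_leP; rewrite tr_scalar_mx => /(_ sA erefl) leAb.
pose e : 'cV[K]_m := delta_mx i 0; pose y := invmx A *m e.
have yE : invmx A i i = y i 0 by rewrite /y -colE mxE.
have Ay : A *m y = e by rewrite mulmxA mulmxV // mul1mx.
have yA : y^T *m A = e^T by rewrite -[A in LHS]sA -trmx_mul Ay.
have eq_y : (e^T *m y) 0 0 = y i 0 by rewrite trmx_delta -rowE mxE.
have eq_e : (e^T *m e) 0 0 = 1 by rewrite trmx_delta -rowE !mxE !eqxx.
have qy : qform A y = y i 0 by rewrite /qform yA eq_y.
clearbody y; have qe : qform A e <= b.
  apply: le_trans (leAb e) _.
  by rewrite /qform mul_mx_scalar -scalemxAl mxE eq_e mulr1.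
have pA x : 0 <= qform A x.
  apply: le_trans (leaA x); rewrite qform_scalar mulr_ge0 ?(ltW a0) //.
  by rewrite sumr_ge0 // => j _; rewrite sqr_ge0.
have qye : qform A (y - b^-1 *: e) = y i 0 - 2 * b^-1 + b^-1 ^+ 2 * qform A e.
  have -> : qform A (y - b^-1 *: e) =
      ((y^T - b^-1 *: e^T) *m A *m (y - b^-1 *: e)) 0 0.
    by rewrite /qform [(_ - _)^T]linearB /= [(_ *: _)^T]linearZ.
  rewrite mulmxBl yA -scalemxAl mulmxBl !mulmxBr -!scalemxAl -!scalemxAr.
  rewrite -(mulmxA _ A y) Ay; move: eq_y eq_e; rewrite /qform.
  move: (e^T *m y) (e^T *m e) (e^T *m A *m e) => p q r.
  by rewrite !mxE => -> ->; ring.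
have yi : a * y i 0 ^+ 2 <= y i 0.
  rewrite -{2}qy; apply: le_trans (leaA y).
  rewrite qform_scalar ler_wpM2l ?(ltW a0) //.
  by rewrite (bigD1 i) //= lerDl sumr_ge0 // => j _; rewrite sqr_ge0.
rewrite yE; apply/andP; split.
  (* Since [qform A e <= b], the value at [y - b^-1 *: e] is at most [y i 0 - b^-1]. *)
  have := pA (y - b^-1 *: e); rewrite qye => h.
  have : b^-1 ^+ 2 * qform A e <= b^-1 ^+ 2 * b by rewrite ler_wpM2l ?sqr_ge0.
  have -> : b^-1 ^+ 2 * b = b^-1 by field; rewrite gt_eqF.
  by move=> h2; lra.
rewrite -[a^-1]mul1r ler_pdivlMr //.
(* Cancelling [y i 0] in [yi] requires it to be positive; otherwise the bound is immediate. *)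
have [y0|y0] := leP (y i 0) 0; first by nra.
rewrite -(ler_pM2r y0) mul1r; apply: le_trans yi.
by have -> : y i 0 * a * y i 0 = a * y i 0 ^+ 2 by ring.
Qed.

Lemma mxtrace_invmx_bounds {a b A} : 0 < a -> 0 < b -> A^T = A ->
  loewner_le a%:M A -> loewner_le A b%:M ->
  m%:R * b^-1 <= \tr (invmx A) <= m%:R * a^-1.
Proof.
move=> a0 b0 sA leaA leAb.
have diag i := andP (invmx_diag_bounds i a0 b0 sA leaA leAb).
have cst (c : K) : m%:R * c = \sum_(i < m) c.
  by rewrite sumr_const card_ord mulr_natl.
by rewrite !cst; apply/andP; split; apply: ler_sum => i _; have [] := diag i.
Qed.

End QuadraticForms.

(** * Entrywise limits of matrices and a power series *)

Section Limits.
Context {K : realType}.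

(** A neighbourhood of [M] contains a product of neighbourhoods of its finitely many entries. *)
Lemma cvg_mx {m n : nat} {T : Type} {F : set_system T} {FF : Filter F}
    (f : T -> 'M[K]_(m, n)) (M : 'M[K]_(m, n)) :
  (forall i j, f x i j @[x --> F] --> M i j) -> f x @[x --> F] --> M.
Proof.
move=> fM A [P MP PA].
suff : F [set x | forall i j, P i j (f x i j)].
  by move=> FP; apply: (@filterS _ F FF _ (f @^-1` A) _ FP) => x; exact: PA.
apply: filter_forall => i; apply: filter_forall => j.
exact: (fM i j _ (MP i j)).
Qed.

Lemma cvg_coord {m n : nat} {T : Type} {F : set_system T}
    (f : T -> 'M[K]_(m, n)) (M : 'M[K]_(m, n)) i j :
  f x @[x --> F] --> M -> f x i j @[x --> F] --> M i j.
Proof.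
move=> fM.
exact: (cvg_comp f (fun N : 'M[K]_(m, n) => N i j) fM
  (@coord_continuous K m n i j M)).
Qed.

Lemma cvg_qform {m : nat} {T : Type} {F : set_system T} {FF : Filter F}
    (f : T -> 'M[K]_m) (M : 'M[K]_m) (v : 'cV[K]_m) :
  f x @[x --> F] --> M -> qform (f x) v @[x --> F] --> qform M v.
Proof.
move=> fM; rewrite qformE; under eq_cvg do rewrite qformE.
do 2![apply: cvg_big => [|? _]; first exact: add_continuous].
by apply: cvgMr_tmp; apply: cvg_coord.
Qed.

(** For each fixed vector the values of the forms are nondecreasing, and the inequality passes to
    the limit. *)
Lemma loewner_le_lim {m : nat} (A : nat -> 'M[K]_m) (M : 'M[K]_m) :
  (forall n, (A n)^T = A n) ->
  (forall i j, (i <= j)%N -> loewner_le (A i) (A j)) ->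
  A n @[n --> \oo] --> M -> M^T = M /\ forall n, loewner_le (A n) M.
Proof.
move=> sA homoA AM.
have sM : M^T = M.
  apply/matrixP => i j; rewrite mxE.
  have Aij : A n i j @[n --> \oo] --> M j i.
    under eq_cvg do rewrite -sA mxE.
    exact: cvg_coord.
  by apply: (cvg_unique (@Rhausdorff K) Aij); apply: cvg_coord.
split=> // n; apply/loewner_leP => // v.
have Av : qform (A k) v @[k --> \oo] --> qform M v by exact: cvg_qform.
apply: (cvgr_to_ge Av).
exists n => // k nk.
exact: (loewner_leP (sA n) (sA k)).1 (homoA _ _ nk) v.
Qed.

(* The terms n^2 t^(n-1) telescope: for 0 <= t < 1 they are the differences of
   t^n P(n) with P(n) = n^2/(1-t) + 2n/(1-t)^2 + (1+t)/(1-t)^3. *)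
Lemma sum_sqr_geometric_le (t : K) n : 0 <= t < 1 ->
  \sum_(0 <= k < n) k%:R ^+ 2 * t ^+ k.-1 <= (1 + t) / (1 - t) ^+ 3.
Proof.
move=> /andP[t0 t1]; have s0 : 0 < 1 - t by rewrite subr_gt0.
have c0 : 0 <= (1 + t) / (1 - t) ^+ 3.
  by rewrite divr_ge0 ?exprn_ge0 ?(ltW s0) // addr_ge0.
pose P (n : nat) : K :=
  n%:R ^+ 2 / (1 - t) + 2 * n%:R / (1 - t) ^+ 2 + (1 + t) / (1 - t) ^+ 3.
have P0 k : 0 <= P k.
  by rewrite !addr_ge0 // divr_ge0 ?exprn_ge0 ?mulr_ge0 ?(ltW s0) ?ler0n.
case: n => [|n]; first by rewrite big_nil.
(* [t ^+ n * P n] is the nonnegative tail of the series, so the left-hand side does not depend on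
   [n]. *)
suff <- : \sum_(0 <= k < n.+1) k%:R ^+ 2 * t ^+ k.-1 + t ^+ n * P n =
    (1 + t) / (1 - t) ^+ 3.
  by rewrite lerDl mulr_ge0 // exprn_ge0.
elim: n => [|n IHn]; first by rewrite big_nat1 /P; field; rewrite gt_eqF.
rewrite big_nat_recr //= -[RHS]IHn -addrA; congr (_ + _).
by rewrite /P (exprS t) -natr1; field; rewrite gt_eqF.
Qed.

(** Absolute convergence: [t] may be negative, while the bound on partial sums is for nonnegative
    ratios. *)
Lemma is_cvg_series_sqr_geometric (t : K) : `|t| < 1 ->
  cvgn (series (fun k : nat => k%:R ^+ 2 * t ^+ k.-1)).
Proof.
move=> t1; apply: normed_cvg; apply: nondecreasing_is_cvgn.
  by apply: nondecreasing_series => k _ _ /=.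
exists ((1 + `|t|) / (1 - `|t|) ^+ 3) => _ [n _ <-].
rewrite [X in X <= _]/series /=.
under eq_bigr do rewrite normrM !normrX normr_nat.
by apply: sum_sqr_geometric_le; rewrite normr_ge0.
Qed.

End Limits.

(** * The moment matrices: monotonicity, convergence, factorization *)

Section MomentMatrices.
Context {K : realType} {m : nat} (R : K) (z : 'I_m -> K) (R_gt0 : 0 < R).

Lemma moment_termE l i j :
  moment_term R z l i j = l%:R ^+ 2 * (z i / R * (z j / R)) ^+ l.-1.
Proof.
rewrite /moment_term /moment_vec !mxE big_ord1 !mxE; congr (_ * _).
exact: esym (exprMn _ _ _).
Qed.

Lemma psdmx_moment_term l : psdmx (moment_term R z l).
Proof.
split=> [|x]; first by rewrite linearZ /= trmx_mul trmxK.
rewrite -/(qform _ x) qformZ mulr_ge0 ?sqr_ge0 //.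
(* The double transpose exhibits the outer product as a Gram matrix. *)
rewrite -{1}[moment_vec R z l]trmxK qform_gram.
by rewrite sumr_ge0 // => i _; rewrite sqr_ge0.
Qed.

Lemma A_polyS L : A_poly R z L.+1 =
  A_poly R z L + (4 * R ^+ 2)^-1 *: moment_term R z L.+1.
Proof. by rewrite /A_poly big_nat_recr //= scalerDr. Qed.

Lemma A_poly_sym L : (A_poly R z L)^T = A_poly R z L.
Proof.
rewrite linearZ /= linear_sum /=; congr (_ *: _).
by apply: eq_bigr => l _; case: (psdmx_moment_term l).
Qed.

Lemma A_poly_homo : forall L L' : nat, (L <= L')%N ->
  loewner_le (A_poly R z L) (A_poly R z L').
Proof.
apply: homo_leq => [A|B A C|L]; last 1 first.
- rewrite A_polyS -[X in loewner_le X]addr0; apply/loewner_leP.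
  + by rewrite addr0 A_poly_sym.
  + by rewrite -A_polyS A_poly_sym.
  move=> x; rewrite addr0 -subr_ge0 -qformB addrC addKr qformZ mulr_ge0 //.
    by rewrite invr_ge0 mulr_ge0 // exprn_ge0 // ltW.
  exact: (psdmx_moment_term L.+1).2.
- rewrite /loewner_le subrr; split=> [|x]; first by rewrite trmx0.
  by rewrite mulmx0 mul0mx mxE.
- exact: loewner_le_trans.
Qed.

Lemma A_poly_cvg : (forall k, `|z k| < R) ->
  A_poly R z L @[L --> \oo] --> A_poly_infty R z.
Proof.
move=> z_lt; apply: cvgZl_tmp.
pose S n := \sum_(1 <= l < n) moment_term R z l.
(* [A_poly] at [L] uses [S L.+1]. The infinite sum is by definition the limit of [S], so only
   convergence remains. *)
rewrite (cvg_shiftS S); suff : cvgn S by [].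
have entry i j : cvgn (fun n => S n i j).
  have t1 : `|z i / R * (z j / R)| < 1.
    have r1 k : `|z k / R| < 1.
      by rewrite normrM normfV (gtr0_norm R_gt0) ltr_pdivrMr // mul1r.
    by rewrite normrM mulr_ilt1.
  have -> : (fun n => S n i j) =
      (fun n => \sum_(1 <= l < n) l%:R ^+ 2 * (z i / R * (z j / R)) ^+ l.-1).
    apply/funext => n; rewrite /S summxE.
    by apply: eq_bigr => l _; rewrite moment_termE.
  by rewrite is_cvg_series_restrict; exact: is_cvg_series_sqr_geometric.
have Slim : S n @[n --> \oo] -->
    (\matrix_(i, j) limn (fun n => S n i j) : 'M[K]_m).
  by apply: cvg_mx => i j; rewrite mxE; apply: entry.
exact: (cvgP _ Slim).
Qed.

(* A_m is the Gram matrix of a row-scaled Vandermonde matrix. *)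
Lemma A_poly_gram : injective z ->
  exists2 B, B \in unitmx & A_poly R z m = B^T *m B.
Proof.
move=> z_inj; pose r := \row_k (z k / R).
(* The square root of the weight [l ^+ 2 / (4 * R ^+ 2)] at [l = i.+1]; row [i] of the Vandermonde
   matrix holds the powers [l.-1]. *)
pose d : 'rV[K]_m := \row_i (i.+1%:R / (2 * R)).
have R0 : R != 0 by rewrite gt_eqF.
exists (diag_mx d *m Vandermonde m r).
  rewrite unitmxE unitfE det_mulmx det_diag det_Vandermonde mulf_neq0 //.
    apply/prodf_neq0 => i _; rewrite mxE mulf_neq0 ?pnatr_eq0 // invr_eq0.
    by rewrite mulf_neq0 // pnatr_eq0.
  apply/prodf_neq0 => i _; apply/prodf_neq0 => j ltij; rewrite !mxE subr_eq0.
  apply: contraTneq ltij => /(divIf R0) /z_inj ->.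
  by rewrite ltnn.
apply/matrixP => i j; rewrite /A_poly mxE summxE big_add1 /= big_mkord mxE.
rewrite mulr_sumr; apply: eq_bigr => k _; rewrite moment_termE.
by rewrite mul_diag_mx !mxE exprMn /=; field.
Qed.

End MomentMatrices.

Theorem proposition5 (K : realType) (m : nat) (R : K) (z : 'I_m -> K)
    (m_gt0 : (0 < m)%N) (R_gt0 : 0 < R) (z_inj : injective z)
    (z_lt : forall k, `|z k| < R) :
  [/\ forall L L' : nat, (L <= L')%N ->
        loewner_le (A_poly R z L) (A_poly R z L'),
      A_poly R z L @[L --> \oo] --> A_poly_infty R z,
      pdmx (A_poly_infty R z),
      exists c_minus c_plus : K,
        [/\ 0 < c_minus, c_minus <= c_plus &
          forall kappa : nat -> K,
            (forall L, (0 < L)%N -> 0 < kappa L) ->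
            forall L : nat, (m <= L)%N ->
              loewner_le ((c_minus * (kappa L)^-1)%:M) (fisher_poly R z kappa L) /\
              loewner_le (fisher_poly R z kappa L) ((c_plus * (kappa L)^-1)%:M)]
    & exists a b : K,
        [/\ 0 < a, a <= b &
          forall kappa : nat -> K,
            (forall L, (0 < L)%N -> 0 < kappa L) ->
            forall L : nat, (m <= L)%N ->
              fisher_poly R z kappa L \in unitmx /\
              a * kappa L <= CRB_poly R z kappa L <= b * kappa L]].
Proof.
have homoA := A_poly_homo R z R_gt0.
have cvgA := A_poly_cvg R z R_gt0 z_lt.
have [sA leA] := loewner_le_lim _ _ (A_poly_sym R z) homoA cvgA.
have [B uB AB] := A_poly_gram R z R_gt0 z_inj.
(* [c] comes from the [m]-th partial sum and [C] from the limit, so neither depends on [L] or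
   [kappa]. *)
have [c c0 lecB] := scalar_loewner_le_gram uB; rewrite -AB in lecB.
have [C C0 leAC] := sym_loewner_le_scalar sA.
have lecA L : (m <= L)%N -> loewner_le c%:M (A_poly R z L).
  by move=> /homoA; apply: loewner_le_trans.
have leACL L := loewner_le_trans (leA L) leAC.
have lecC : c <= C.
  have /loewner_leP := loewner_le_trans (lecA m (leqnn m)) (leACL m).
  (* The all-ones vector has squared norm [m > 0], which can be cancelled. *)
  rewrite !tr_scalar_mx => /(_ erefl erefl) /(_ (const_mx 1)).
  rewrite !qform_scalar ler_pM2r //; under eq_bigr do rewrite mxE expr1n.
  by rewrite sumr_const card_ord ltr0n.
have fisher_bounds kappa : (forall L, (0 < L)%N -> 0 < kappa L) ->
    forall L, (m <= L)%N ->
      loewner_le ((c * (kappa L)^-1)%:M) (fisher_poly R z kappa L) /\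
      loewner_le (fisher_poly R z kappa L) ((C * (kappa L)^-1)%:M).
  move=> kappa0 L mL; have k0 := ltW (kappa0 L (leq_trans m_gt0 mL)).
  rewrite ![_ * (kappa L)^-1]mulrC -!scale_scalar_mx.
  by split; apply: loewner_leZ; rewrite ?invr_ge0 //; apply: lecA.
split=> //; first exact: scalar_loewner_le_pd c0 sA
  (loewner_le_trans (lecA m (leqnn m)) (leA m)).
  by exists c, C.
have m0 : 0 < m%:R :> K by rewrite ltr0n.
(* Inversion swaps the two bounds, and the trace adds up [m] diagonal entries. *)
exists (m%:R / C), (m%:R / c); split=> [||kappa kappa0 L mL].
- by rewrite divr_gt0.
- by rewrite ler_pM2l // lef_pV2.
have k0 := kappa0 L (leq_trans m_gt0 mL).
have [lel leu] := fisher_bounds kappa kappa0 L mL.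
have sF : (fisher_poly R z kappa L)^T = fisher_poly R z kappa L.
  by rewrite linearZ /= A_poly_sym.
have ck0 : 0 < c * (kappa L)^-1 by rewrite divr_gt0.
have Ck0 : 0 < C * (kappa L)^-1 by rewrite divr_gt0.
split; first exact: pdmx_unit (scalar_loewner_le_pd ck0 sF lel).
have := mxtrace_invmx_bounds ck0 Ck0 sF lel leu.
by rewrite !invfM !invrK !mulrA.
Qed.
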